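(* Every polynomial identity of degree $\le 3$ relating the bilinear operation $[x,y]=\alpha(x\wedge y)$ and the trilinear operation $(x,y,z)=\beta(x\wedge y)\cdot z$ on the $\mathfrak{sl}(2,\mathbb{C})$-module $V(6)$ is a consequence of the anticommutativity $[a,b]+[b,a]\equiv0$, the skew-symmetry $(a,b,c)+(b,a,c)\equiv0$, and the mixed Jacobi identity $$[[a,b],c]+[[b,c],a]+[[c,a],b]+(a,b,c)+(b,c,a)+(c,a,b)\equiv0.$$
   Context: $V(6)$ is the 7-dimensional irreducible $\mathfrak{sl}(2,\mathbb{C})$-module with basis $v_6,v_4,v_2,v_0,v_{-2},v_{-4},v_{-6}$ of $H$-eigenvectors, where $H\cdot v_{6-2i}=(6-2i)v_{6-2i}$, $E\cdot v_{6-2i}=(7-i)v_{6-2(i-1)}$, $F\cdot v_{6-2i}=(i+1)v_{6-2(i+1)}$ (with $v_8=v_{-8}=0$). Here $H,E,F$ is the standard basis of $\mathfrak{sl}(2,\mathbb{C})$, with $[H,E]=2E$, $[H,F]=-2F$, $[E,F]=H$. The map $\alpha\colon\Lambda^2V(6)\to V(6)$ is the (unique up to nonzero scalar) nonzero $\mathfrak{sl}(2,\mathbb{C})$-module morphism, normalized so that $[x,y]=\alpha(x\wedge y)$ is the anticommutative product with $[v_6,v_0]=20v_6$, $[v_6,v_{-2}]=10v_4$, $[v_6,v_{-4}]=4v_2$, $[v_6,v_{-6}]=v_0$, $[v_4,v_2]=-60v_6$, $[v_4,v_0]=-20v_4$, $[v_4,v_{-4}]=6v_0$, $[v_4,v_{-6}]=4v_{-2}$,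 $[v_2,v_0]=-20v_2$, $[v_2,v_{-2}]=-15v_0$, $[v_2,v_{-6}]=10v_{-4}$, $[v_0,v_{-2}]=-20v_{-2}$, $[v_0,v_{-4}]=-20v_{-4}$, $[v_0,v_{-6}]=20v_{-6}$, $[v_{-2},v_{-4}]=-60v_{-6}$, and all other products $[v_p,v_q]$ with $p>q$ equal to $0$. The map $\beta\colon\Lambda^2V(6)\to V(2)\approx\mathfrak{sl}(2,\mathbb{C})$ is an $\mathfrak{sl}(2,\mathbb{C})$-module morphism, unique up to nonzero scalar; its scalar is chosen compatibly with $\alpha$ as $\beta=-30\,\beta_0$, where, with $u_2=-E$, $u_0=H$, $u_{-2}=F$, $\beta_0(v_6\wedge v_{-4})=2u_2$, $\beta_0(v_6\wedge v_{-6})=u_0$, $\beta_0(v_4\wedge v_{-2})=-10u_2$, $\beta_0(v_4\wedge v_{-4})=-4u_0$, $\beta_0(v_4\wedge v_{-6})=2u_{-2}$, $\beta_0(v_2\wedge v_0)=20u_2$, $\beta_0(v_2\wedge v_{-2})=5u_0$, $\beta_0(v_2\wedge v_{-4})=-10u_{-2}$, $\beta_0(v_0\wedge v_{-2})=20u_{-2}$, and $\beta_0(v_p\wedge v_q)=0$ for all other $p>q$. The dot in $\beta(x\wedge y)\cdot z$ is the action of $\mathfrak{sl}(2,\mathbb{C})$ on $V(6)$. A polynomial identity of degree $\le n$ relating the two operations is a nonassociative polynomial over $\mathbb{C}$ of degree $\le n$, each of whose monomials may involve the bilinear operation, the trilinear operation, or both, which vanishes for all substitutions of elements of $V(6)$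 for the variables. An identity is a consequence of a set of identities if it is satisfied by every vector space over $\mathbb{C}$ with a bilinear and a trilinear operation satisfying all identities in the set. *)

(* Defs.v *)
From HB Require Import structures.
From mathcomp Require Import all_boot all_order all_algebra.
From mathcomp Require Import finmap.
From mathcomp.multinomials Require Import monalg.
From mathcomp Require Import reals complex ring.

Set Implicit Arguments.
Unset Strict Implicit.
Unset Printing Implicit Defensive.

Import GRing.Theory.
Local Open Scope ring_scope.

(* Nonassociative monomials in the variables x_0, x_1, ... for one bilinear   *)
(* operation [_, _] and one trilinear operation (_, _, _); there is no unit.  *)

Inductive monomial : Type :=
| Var of nat
| Br of monomial & monomial
| Tr of monomial & monomial & monomial.

Fixpoint monomial_encode (m : monomial) : GenTree.tree nat :=
  match m with
  | Var i => GenTree.Leaf i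
  | Br m1 m2 => GenTree.Node 0%N [:: monomial_encode m1; monomial_encode m2]
  | Tr m1 m2 m3 =>
      GenTree.Node 1%N
        [:: monomial_encode m1; monomial_encode m2; monomial_encode m3]
  end.

Fixpoint monomial_decode (t : GenTree.tree nat) : monomial :=
  match t with
  | GenTree.Leaf i => Var i
  | GenTree.Node _ [:: t1; t2] => Br (monomial_decode t1) (monomial_decode t2)
  | GenTree.Node _ [:: t1; t2; t3] =>
      Tr (monomial_decode t1) (monomial_decode t2) (monomial_decode t3)
  | GenTree.Node _ _ => Var 0%N
  end.

Lemma monomial_encodeK : cancel monomial_encode monomial_decode.
Proof. by elim=> [i|m1 /= -> m2 ->|m1 /= -> m2 -> m3 ->]. Qed.

HB.instance Definition _ := Countable.copy monomial (can_type monomial_encodeK).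

Fixpoint monomial_degree (m : monomial) : nat :=
  match m with
  | Var _ => 1%N
  | Br m1 m2 => (monomial_degree m1 + monomial_degree m2)%N
  | Tr m1 m2 m3 =>
      (monomial_degree m1 + monomial_degree m2 + monomial_degree m3)%N
  end.

Notation napoly K := {malg K[monomial]}.

Definition degree (K : fieldType) (p : napoly K) : nat :=
  (\max_(m <- msupp p) monomial_degree m)%N.

Record btAlgebra (K : fieldType) := BTAlgebra {
  bt_sort :> lmodType K;
  bt_br : bt_sort -> bt_sort -> bt_sort;
  bt_tr : bt_sort -> bt_sort -> bt_sort -> bt_sort;
  bt_br_linear1 : forall y, linear (fun x => bt_br x y);
  bt_br_linear2 : forall x, linear (fun y => bt_br x y);
  bt_tr_linear1 : forall y z, linear (fun x => bt_tr x y z);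
  bt_tr_linear2 : forall x z, linear (fun y => bt_tr x y z);
  bt_tr_linear3 : forall x y, linear (fun z => bt_tr x y z) }.

Fixpoint meval (K : fieldType) (A : btAlgebra K) (s : nat -> A) (m : monomial)
    : A :=
  match m with
  | Var i => s i
  | Br m1 m2 => bt_br (meval s m1) (meval s m2)
  | Tr m1 m2 m3 => bt_tr (meval s m1) (meval s m2) (meval s m3)
  end.

Definition peval (K : fieldType) (A : btAlgebra K) (s : nat -> A)
    (p : napoly K) : A :=
  \sum_(m <- msupp p) p@_m *: meval s m.

Definition satisfies (K : fieldType) (A : btAlgebra K) (p : napoly K) : Prop :=
  forall s : nat -> A, peval s p = 0.

Definition consequence (K : fieldType) (S : napoly K -> Prop) (p : napoly K)
    : Prop :=
  forall A : btAlgebra K, (forall q, S q -> satisfies A q) -> satisfies A p.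

Definition anticommutativity (K : fieldType) : napoly K :=
  let a := Var 0%N in let b := Var 1%N in << Br a b >> + << Br b a >>.

Definition skew_symmetry (K : fieldType) : napoly K :=
  let a := Var 0%N in let b := Var 1%N in let c := Var 2%N in
  << Tr a b c >> + << Tr b a c >>.

Definition mixed_jacobi (K : fieldType) : napoly K :=
  let a := Var 0%N in let b := Var 1%N in let c := Var 2%N in
  << Br (Br a b) c >> + << Br (Br b c) a >> + << Br (Br c a) b >>
  + << Tr a b c >> + << Tr b c a >> + << Tr c a b >>.

Section V6.
Variable K : fieldType.

Definition sl2H : 'M[K]_2 := delta_mx 0 0 - delta_mx 1 1.
Definition sl2E : 'M[K]_2 := delta_mx 0 1.
Definition sl2F : 'M[K]_2 := delta_mx 1 0.

Lemma sl2_relations :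
  [/\ sl2H *m sl2E - sl2E *m sl2H = sl2E *+ 2,
      sl2H *m sl2F - sl2F *m sl2H = - sl2F *+ 2 &
      sl2E *m sl2F - sl2F *m sl2E = sl2H].
Proof.
rewrite /sl2H /sl2E /sl2F !(mulmxBl, mulmxBr) !mul_delta_mx_cond /=.
by split; rewrite !(mulr1n, mulr0n, subr0, sub0r, opprB, opprK, mulr2n, opprD).
Qed.

(* V(6) is realized on 'rV_7: coordinate i is the one on v_{6-2i}.            *)
Notation V := 'rV[K]_7.

Definition weight (i : nat) : int := 6 - 2 * i%:Z.

(* The weight vector v_p; it is 0 when p is not a weight, e.g. p = 8, -8.     *)
Definition v_ (p : int) : V := \row_(i < 7) (p == weight i)%:R.

Definition vcoef (p : int) (x : V) : K := \sum_(i < 7 | p == weight i) x 0 i.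

Definition linear_ext (f : nat -> V) (x : V) : V := \sum_(i < 7) x 0 i *: f i.

Definition actH : V -> V := linear_ext (fun i => (weight i)%:~R *: v_ (weight i)).

Definition actE : V -> V :=
  linear_ext (fun i => (7 - i)%:R *: v_ (6 - 2 * (i%:Z - 1))).

Definition actF : V -> V :=
  linear_ext (fun i => i.+1%:R *: v_ (6 - 2 * (i%:Z + 1))).

(* A traceless X equals X 0 0 *: sl2H + X 0 1 *: sl2E + X 1 0 *: sl2F.        *)
Definition act (X : 'M[K]_2) (x : V) : V :=
  X 0 0 *: actH x + X 0 1 *: actE x + X 1 0 *: actF x.

(* The coefficient of v_p /\ v_q in x /\ y, for weights p > q.                *)
Definition wedge (x y : V) (p q : int) : K :=
  vcoef p x * vcoef q y - vcoef q x * vcoef p y.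

Definition alpha (x y : V) : V :=
  let w := wedge x y in
    (20 * w 6 0) *: v_ 6 + (10 * w 6 (-2)) *: v_ 4 + (4 * w 6 (-4)) *: v_ 2
  + w 6 (-6) *: v_ 0 - (60 * w 4 2) *: v_ 6 - (20 * w 4 0) *: v_ 4
  + (6 * w 4 (-4)) *: v_ 0 + (4 * w 4 (-6)) *: v_ (-2) - (20 * w 2 0) *: v_ 2
  - (15 * w 2 (-2)) *: v_ 0 + (10 * w 2 (-6)) *: v_ (-4)
  - (20 * w 0 (-2)) *: v_ (-2) - (20 * w 0 (-4)) *: v_ (-4)
  + (20 * w 0 (-6)) *: v_ (-6) - (60 * w (-2) (-4)) *: v_ (-6).

Definition beta0 (x y : V) : 'M[K]_2 :=
  let w := wedge x y in
  let u2 := - sl2E in let u0 := sl2H in let um2 := sl2F in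
    (2 * w 6 (-4)) *: u2 + w 6 (-6) *: u0 - (10 * w 4 (-2)) *: u2
  - (4 * w 4 (-4)) *: u0 + (2 * w 4 (-6)) *: um2 + (20 * w 2 0) *: u2
  + (5 * w 2 (-2)) *: u0 - (10 * w 2 (-4)) *: um2 + (20 * w 0 (-2)) *: um2.

Definition beta (x y : V) : 'M[K]_2 := - 30%:R *: beta0 x y.

Lemma vcoef_is_linear p : linear (vcoef p : V -> K^o).
Proof.
move=> k x y; rewrite /vcoef scaler_sumr -big_split /=.
by apply: eq_bigr => i _; rewrite !mxE.
Qed.
HB.instance Definition _ p :=
  GRing.isLinear.Build K V K^o _ (vcoef p) (vcoef_is_linear p).

Lemma vcoefD p x y : vcoef p (x + y) = vcoef p x + vcoef p y.
Proof. exact: linearD. Qed.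
Lemma vcoefZ p k x : vcoef p (k *: x) = k * vcoef p x.
Proof. exact: linearZ. Qed.

Lemma linear_ext_is_linear f : linear (linear_ext f).
Proof.
move=> k x y; rewrite /linear_ext scaler_sumr -big_split /=.
by apply: eq_bigr => i _; rewrite !mxE scalerDl scalerA.
Qed.

Lemma act_is_linear X : linear (act X).
Proof.
move=> k x y; rewrite /act /actH /actE /actF !linear_ext_is_linear.
by apply/rowP => i; rewrite !mxE; ring.
Qed.

Lemma alpha_is_linear1 y : linear (alpha^~ y).
Proof.
by move=> k x x'; apply/rowP => i; rewrite /alpha /wedge !(vcoefD, vcoefZ) !mxE;
  ring.
Qed.

Lemma alpha_is_linear2 x : linear (alpha x).
Proof.
by move=> k y y'; apply/rowP => i; rewrite /alpha /wedge !(vcoefD, vcoefZ) !mxE;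
  ring.
Qed.

Lemma beta_is_linear1 y : linear (beta^~ y).
Proof.
move=> k x x'; apply/matrixP => i j.
by rewrite /beta /beta0 /wedge !(vcoefD, vcoefZ) !mxE; ring.
Qed.

Lemma beta_is_linear2 x : linear (beta x).
Proof.
move=> k y y'; apply/matrixP => i j.
by rewrite /beta /beta0 /wedge !(vcoefD, vcoefZ) !mxE; ring.
Qed.

Lemma act_is_linear_l x : linear (act^~ x).
Proof. by move=> k X Y; apply/rowP => i; rewrite /act !mxE; ring. Qed.

Lemma beta_sl2 x y : \tr (beta x y) = 0.
Proof. by rewrite /beta /beta0 /mxtrace !big_ord_recl big_ord0 !mxE /=; ring. Qed.

Definition V6 : btAlgebra K.
refine (@BTAlgebra K V alpha (fun x y z => act (beta x y) z)
  alpha_is_linear1 alpha_is_linear2 _ _ _).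
- by move=> y z k x x'; rewrite /= beta_is_linear1 act_is_linear_l.
- by move=> x z k y y'; rewrite /= beta_is_linear2 act_is_linear_l.
- by move=> x y; exact: act_is_linear.
Defined.

End V6.

(* Main.v *)
Require Import Defs.
From mathcomp Require Import all_boot all_order all_algebra reals complex.
From mathcomp Require Import finmap ring zify.
From mathcomp.multinomials Require Import monalg.

Set Implicit Arguments.
Unset Strict Implicit.
Unset Printing Implicit Defensive.

Import GRing.Theory.
Local Open Scope ring_scope.
Local Open Scope complex_scope.

(** Only finitely many variables occur in p, say N of them, and a monomial of
    degree at most 3 is, up to renaming variables, one of x, [x,y], [[x,y],z],
    [z,[x,y]], (x,y,z). In an algebra where [_,_] is anticommutative, the
    value of p is therefore L x + Q x x + C x x x with L, Q, C multilinear
    forms in the tuple x of values of the variables; [z,[x,y]] has been absorbed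
    into [[x,y],z], so that C is given by a coefficient d(i,j,k) for each
    [[x_i,x_j],x_k] and a coefficient t(i,j,k) for each (x_i,x_j,x_k)
    ([peval_degree3]).

    Suppose that p vanishes on V(6). In characteristic 0 the homogeneous parts
    vanish separately, and so do their polarizations ([polarization]).
    Evaluating the polarized forms at tuples with a single nonzero entry
    isolates the coefficients at a given triple (i,j,k), whether or not the three
    indices are distinct: if D(i,j,k) = d(i,j,k) - d(j,i,k) and T is defined
    likewise from t, then
      D(i,j,k) [[a,b],c] + T(i,j,k) (a,b,c) + its cyclic rotations = 0
    for all a, b, c in V(6) ([V6_polar_identities]). Three choices of (a,b,c)
    suffice to solve this system ([V6_cubic_polar_coef]):
      (v_6, v_0, v_0)      shows that D is invariant under cyclic rotation,
      (v_6, v_-4, v_-4)    shows the same for T,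
      (v_6, v_2, v_-2)     then yields D = T.

    In any algebra satisfying the three laws, 6 C x x x is the sum over (i,j,k)
    of the same cyclic expressions, now at (x_i,x_j,x_k)
    ([cubic_form_cyclic_sum]). As the six coefficients agree, each summand is a
    multiple of the left-hand side of the mixed Jacobi identity, so C x x x = 0.
    The linear and the quadratic part vanish because v_6 and [v_6,v_0] are
    nonzero in V(6). *)

(** * Evaluation of nonassociative polynomials *)

(** Freeing the support of p lets values of different polynomials be summed over
    one index sequence. *)
Lemma peval_sub (K : fieldType) (A : btAlgebra K) (s : nat -> A) (p : napoly K)
    (E : seq monomial) :
  uniq E -> {subset msupp p <= E} ->
  peval s p = \sum_(m <- E) p@_m *: meval s m.
Proof.
move=> uE sE; rewrite (bigID (mem (msupp p))) /= addrC big1 => [|m]; last first.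
  by move/mcoeff_outdom=> ->; rewrite scale0r.
rewrite add0r -big_filter /peval; apply: perm_big; apply: uniq_perm => //.
  exact: filter_uniq.
by move=> m; rewrite mem_filter andb_idr //; exact: sE.
Qed.

Lemma pevalD (K : fieldType) (A : btAlgebra K) (s : nat -> A) (p q : napoly K) :
  peval s (p + q) = peval s p + peval s q.
Proof.
pose E := undup (msupp p ++ msupp q).
have sE r : (forall m, m \in msupp r -> (m \in msupp p) || (m \in msupp q)) ->
    peval s r = \sum_(m <- E) r@_m *: meval s m.
  move=> sr; apply: peval_sub; first exact: undup_uniq.
  by move=> m; rewrite mem_undup mem_cat; exact: sr.
rewrite !sE => [|m ->|m ->|m]; rewrite ?orbT //.
  by rewrite -big_split; apply: eq_bigr => m _; rewrite mcoeffD scalerDl.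
by move/(fsubsetP (msuppD_le _ _)); rewrite in_fsetU.
Qed.

Lemma pevalU (K : fieldType) (A : btAlgebra K) (s : nat -> A) (m : monomial) :
  peval s << m >> = meval s m.
Proof.
rewrite (@peval_sub _ _ _ _ [:: m]) // ?big_seq1 ?mcoeffUU ?scale1r // => m'.
by rewrite -mcoeff_neq0 mcoeffU inE; case: (eqVneq m m'); rewrite ?mulr0n ?eqxx.
Qed.

(** * Monomials of degree at most three *)

Fixpoint var_bound (m : monomial) : nat :=
  match m with
  | Var i => i.+1
  | Br m1 m2 => maxn (var_bound m1) (var_bound m2)
  | Tr m1 m2 m3 => maxn (maxn (var_bound m1) (var_bound m2)) (var_bound m3)
  end.

Lemma monomial_degree_gt0 (m : monomial) : (0 < monomial_degree m)%N.
Proof. by elim: m => //= *; lia. Qed.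

Lemma degree1_Var m : (monomial_degree m <= 1)%N -> exists i, m = Var i.
Proof.
case: m => [i|m1 m2|m1 m2 m3] /= dm; first by exists i.
  have := monomial_degree_gt0 m1; have := monomial_degree_gt0 m2; lia.
have := monomial_degree_gt0 m1; have := monomial_degree_gt0 m2; lia.
Qed.

Inductive cubic_shape : monomial -> Prop :=
| ShapeVar i : cubic_shape (Var i)
| ShapeBr i j : cubic_shape (Br (Var i) (Var j))
| ShapeBrl i j k : cubic_shape (Br (Br (Var i) (Var j)) (Var k))
| ShapeBrr i j k : cubic_shape (Br (Var k) (Br (Var i) (Var j)))
| ShapeTr i j k : cubic_shape (Tr (Var i) (Var j) (Var k)).

Lemma degree2_shape m : (monomial_degree m <= 2)%N ->
  (exists i, m = Var i) \/ (exists i j, m = Br (Var i) (Var j)).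
Proof.
case: m => [i|m1 m2|m1 m2 m3] /= dm; first by left; exists i.
  have d1 := monomial_degree_gt0 m1; have d2 := monomial_degree_gt0 m2.
  have [|i ->] := @degree1_Var m1; first by lia.
  have [|j ->] := @degree1_Var m2; first by lia.
  by right; exists i, j.
have d1 := monomial_degree_gt0 m1; have d2 := monomial_degree_gt0 m2.
have d3 := monomial_degree_gt0 m3; lia.
Qed.

Lemma degree3_shape m : (monomial_degree m <= 3)%N -> cubic_shape m.
Proof.
case: m => [i|m1 m2|m1 m2 m3] /= dm; first exact: ShapeVar.
  have d1 := monomial_degree_gt0 m1; have d2 := monomial_degree_gt0 m2.
  have [|[i e1]|[i [j e1]]] := @degree2_shape m1; first lia.
    have [|[j e2]|[j [k e2]]] := @degree2_shape m2; first lia.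
      by rewrite e1 e2; exact: ShapeBr.
    by rewrite e1 e2; exact: ShapeBrr.
  have [|k e2] := @degree1_Var m2; first by rewrite e1 /= in dm; lia.
  by rewrite e1 e2; exact: ShapeBrl.
have d1 := monomial_degree_gt0 m1; have d2 := monomial_degree_gt0 m2.
have d3 := monomial_degree_gt0 m3.
have [|i ->] := @degree1_Var m1; first by lia.
have [|j ->] := @degree1_Var m2; first by lia.
have [|k ->] := @degree1_Var m3; first by lia.
exact: ShapeTr.
Qed.

(** * The value of a polynomial of degree at most three *)

Definition anticommutative (K : fieldType) (A : btAlgebra K) :=
  forall x y : A, bt_br x y = - bt_br y x.
Definition skew_triple (K : fieldType) (A : btAlgebra K) :=
  forall x y z : A, bt_tr x y z = - bt_tr y x z.

(** With coefficients for left-normed brackets and for triple products only,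
    these terms span the cubic part of the free anticommutative algebra. *)
Definition cubic_term (K : fieldType) (A : btAlgebra K) (d t : K)
    (a b c : A) : A :=
  d *: bt_br (bt_br a b) c + t *: bt_tr a b c.

Definition lin_form (K : fieldType) (A : btAlgebra K) N (c : 'I_N -> K)
    (x : {ffun 'I_N -> A}) : A := \sum_i c i *: x i.
Definition quad_form (K : fieldType) (A : btAlgebra K) N (b : 'I_N -> 'I_N -> K)
    (x y : {ffun 'I_N -> A}) : A := \sum_i \sum_j b i j *: bt_br (x i) (y j).
Definition cubic_form (K : fieldType) (A : btAlgebra K) N
    (d t : 'I_N -> 'I_N -> 'I_N -> K) (x y z : {ffun 'I_N -> A}) : A :=
  \sum_i \sum_j \sum_k cubic_term (d i j k) (t i j k) (x i) (y j) (z k).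

Definition lin_coef {K : fieldType} (p : napoly K) {N} (i : 'I_N) : K :=
  p@_(Var i).
Definition quad_coef {K : fieldType} (p : napoly K) {N} (i j : 'I_N) : K :=
  p@_(Br (Var i) (Var j)).
(** The difference is what [z,[x,y]] = - [[x,y],z] leaves of the two bracket
    monomials. *)
Definition brbr_coef {K : fieldType} (p : napoly K) {N} (i j k : 'I_N) : K :=
  p@_(Br (Br (Var i) (Var j)) (Var k)) - p@_(Br (Var k) (Br (Var i) (Var j))).
Definition tr_coef {K : fieldType} (p : napoly K) {N} (i j k : 'I_N) : K :=
  p@_(Tr (Var i) (Var j) (Var k)).

(** The five shapes of monomials on N variables are enumerated injectively by a
    disjoint union of finite types; this enumeration contains the support of p,
    so the value of p is a sum over it. *)
Lemma peval_degree3 (K : fieldType) (A : btAlgebra K) (p : napoly K) N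
    (s : nat -> A) (x : {ffun 'I_N -> A}) :
  anticommutative A -> (degree p <= 3)%N ->
  (forall m, m \in msupp p -> (var_bound m <= N)%N) ->
  (forall i : 'I_N, s i = x i) ->
  peval s p = lin_form (lin_coef p) x + quad_form (quad_coef p) x x
    + cubic_form (brbr_coef p) (tr_coef p) x x x.
Proof.
move=> antiA degp boundp sx.
pose triples : finType := ('I_N * ('I_N * 'I_N))%type.
pose shapes : finType := ('I_N + 'I_N * 'I_N + triples + triples + triples)%type.
pose shape (u : shapes) : monomial :=
  match u with
  | inl (inl (inl (inl i))) => Var i
  | inl (inl (inl (inr (i, j)))) => Br (Var i) (Var j)
  | inl (inl (inr (i, (j, k)))) => Br (Br (Var i) (Var j)) (Var k)
  | inl (inr (i, (j, k))) => Br (Var k) (Br (Var i) (Var j))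
  | inr (i, (j, k)) => Tr (Var i) (Var j) (Var k)
  end.
have shape_inj : injective shape.
  case=> [[[[i|[i j]]|[i [j k]]]|[i [j k]]]|[i [j k]]];
  case=> [[[[i'|[i' j']]|[i' [j' k']]]|[i' [j' k']]]|[i' [j' k']]] //=;
  by case=> *; repeat congr (_, _) || congr inl || congr inr; apply: val_inj.
rewrite (@peval_sub _ _ _ _ [seq shape u | u : shapes]); first last.
- move=> m mp; have := boundp m mp.
  have : cubic_shape m.
    exact/degree3_shape/(leq_trans _ degp)/(leq_bigmax_seq _ mp).
  move=> sm bm; apply/mapP; suff [u ->] : exists u, m = shape u.
    by exists u; rewrite ?mem_enum.
  case: sm bm => [i|i j|i j k|i j k|i j k] /=; rewrite ?geq_max.
  + by move=> iN; exists (inl (inl (inl (inl (Ordinal iN))))).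
  + case/andP=> iN jN.
    by exists (inl (inl (inl (inr (Ordinal iN, Ordinal jN))))).
  + case/andP=> /andP[iN jN] kN.
    by exists (inl (inl (inr (Ordinal iN, (Ordinal jN, Ordinal kN))))).
  + case/and3P=> kN iN jN.
    by exists (inl (inr (Ordinal iN, (Ordinal jN, Ordinal kN)))).
  + case/andP=> /andP[iN jN] kN.
    by exists (inr (Ordinal iN, (Ordinal jN, Ordinal kN))).
- by rewrite map_inj_uniq // enum_uniq.
rewrite big_image /= !big_sumType /= -!addrA; congr (_ + _).
  by apply: eq_bigr => i _; rewrite sx.
congr (_ + _).
  rewrite /quad_form pair_bigA; apply: eq_bigr => -[i j] _ /=.
  by rewrite !sx.
rewrite /cubic_form -!big_split /=.
under [RHS]eq_bigr => i _ do rewrite pair_bigA.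
rewrite [RHS]pair_bigA; apply: eq_bigr => -[i [j k]] _ /=.
rewrite !sx /cubic_term [bt_br (x k) _]antiA.
by rewrite scalerN scalerBl addrA.
Qed.

(** * Polarization *)

(** The homogeneous parts are separated by evaluating at x, x + x and
    x + x + x, whose three equations form a Vandermonde system; the symmetrized
    multilinear forms are then the second difference of x |-> Q x x and the third
    difference of x |-> C x x x. *)
Lemma polarization (U : nmodType) (K : fieldType) (L : U -> K)
    (Q : U -> U -> K) (C : U -> U -> U -> K) :
  has_char0 K ->
  (forall x x', L (x + x') = L x + L x') ->
  (forall x x' y, Q (x + x') y = Q x y + Q x' y) ->
  (forall x y y', Q x (y + y') = Q x y + Q x y') ->
  (forall x x' y z, C (x + x') y z = C x y z + C x' y z) ->
  (forall x y y' z, C x (y + y') z = C x y z + C x y' z) ->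
  (forall x y z z', C x y (z + z') = C x y z + C x y z') ->
  (forall x, L x + Q x x + C x x x = 0) ->
  [/\ forall x, L x = 0, forall x y, Q x y + Q y x = 0 &
      forall x y z, (C x y z + C y x z) + (C y z x + C z y x)
                    + (C z x y + C x z y) = 0].
Proof.
move=> /pcharf0P char0 LD QD1 QD2 CD1 CD2 CD3 f0.
have nat0 n (k : K) : n.+1%:R * k = 0 -> k = 0.
  by move/eqP; rewrite mulf_eq0 char0 => /eqP.
have L0 x : L x = 0.
  (* The weights 18, -9, 2 at x, 2x, 3x cancel the quadratic and cubic terms. *)
  apply: (nat0 5).
  transitivity (18 * (L x + Q x x + C x x x)
    - 9 * (L (x + x) + Q (x + x) (x + x) + C (x + x) (x + x) (x + x))
    + 2 * (L (x + x + x) + Q (x + x + x) (x + x + x)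
           + C (x + x + x) (x + x + x) (x + x + x))).
    by rewrite !(LD, QD1, QD2, CD1, CD2, CD3); ring.
  by rewrite !f0; ring.
have Q0 x : Q x x = 0.
  apply: (nat0 3).
  transitivity (8 * (L x + Q x x + C x x x)
    - (L (x + x) + Q (x + x) (x + x) + C (x + x) (x + x) (x + x))).
    by rewrite !L0 !(QD1, QD2, CD1, CD2, CD3); ring.
  by rewrite !f0; ring.
have C0 x : C x x x = 0 by have := f0 x; rewrite L0 Q0 !add0r.
split=> // [x y|x y z].
  by have := Q0 (x + y); rewrite !(QD1, QD2) !Q0 add0r addr0.
transitivity (C (x + y + z) (x + y + z) (x + y + z)
  - C (x + y) (x + y) (x + y) - C (y + z) (y + z) (y + z)
  - C (x + z) (x + z) (x + z) + C x x x + C y y y + C z z z).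
  by rewrite !(CD1, CD2, CD3); ring.
by rewrite !C0; ring.
Qed.

(** * Multilinear forms in an algebra *)

Lemma linearDf (K : fieldType) (U V : lmodType K) (f : U -> V) :
  linear f -> forall x y, f (x + y) = f x + f y.
Proof. by move=> lf x y; have := lf 1 x y; rewrite !scale1r. Qed.

Lemma linear0f (K : fieldType) (U V : lmodType K) (f : U -> V) :
  linear f -> f 0 = 0.
Proof.
by move=> lf; have := lf (-1) 0 0; rewrite scaler0 addr0 scaleN1r addNr.
Qed.

Section MultilinearForms.
Variables (K : fieldType) (A : btAlgebra K).
Implicit Types (a b c : A) (d t : K).

Lemma brDl a a' b : bt_br (a + a') b = bt_br a b + bt_br a' b.
Proof. exact: (linearDf (bt_br_linear1 b)). Qed.
Lemma brDr a b b' : bt_br a (b + b') = bt_br a b + bt_br a b'.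
Proof. exact: (linearDf (bt_br_linear2 a)). Qed.
Lemma br0l b : bt_br 0 b = 0 :> A.
Proof. exact: (linear0f (bt_br_linear1 b)). Qed.
Lemma br0r a : bt_br a 0 = 0.
Proof. exact: (linear0f (bt_br_linear2 a)). Qed.

Lemma cubic_termDl d t a a' b c :
  cubic_term d t (a + a') b c = cubic_term d t a b c + cubic_term d t a' b c.
Proof.
by rewrite /cubic_term (linearDf (bt_tr_linear1 b c)) !brDl !scalerDr addrACA.
Qed.
Lemma cubic_termDm d t a b b' c :
  cubic_term d t a (b + b') c = cubic_term d t a b c + cubic_term d t a b' c.
Proof.
by rewrite /cubic_term (linearDf (bt_tr_linear2 a c)) brDr brDl !scalerDr addrACA.
Qed.
Lemma cubic_termDr d t a b c c' :
  cubic_term d t a b (c + c') = cubic_term d t a b c + cubic_term d t a b c'.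
Proof.
by rewrite /cubic_term (linearDf (bt_tr_linear3 a b)) brDr !scalerDr addrACA.
Qed.
Lemma cubic_term0l d t b c : cubic_term d t 0 b c = 0.
Proof.
by rewrite /cubic_term (linear0f (bt_tr_linear1 b c)) !br0l !scaler0 addr0.
Qed.
Lemma cubic_term0m d t a c : cubic_term d t a 0 c = 0.
Proof.
by rewrite /cubic_term (linear0f (bt_tr_linear2 a c)) br0r br0l !scaler0 addr0.
Qed.
Lemma cubic_term0r d t a b : cubic_term d t a b 0 = 0.
Proof.
by rewrite /cubic_term (linear0f (bt_tr_linear3 a b)) br0r !scaler0 addr0.
Qed.

(** Exchanging the first two arguments changes the sign of both operations, so
    only the alternating part of the coefficients is visible. *)
Lemma skew_pair_cubic_term d d' t t' a b c :
  anticommutative A -> skew_triple A ->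
  cubic_term d t a b c + cubic_term d' t' b a c
  = cubic_term (d - d') (t - t') a b c.
Proof.
move=> antiA skewA; rewrite /cubic_term [bt_tr b a c]skewA [bt_br b a]antiA.
have -> : bt_br (- bt_br a b) c = - bt_br (bt_br a b) c.
  by apply/eqP; rewrite -addr_eq0 -brDl addNr br0l.
by rewrite !scalerN !scalerBl addrACA.
Qed.

Section Forms.
Variables (N : nat).
Implicit Types (x y z : {ffun 'I_N -> A}).

Definition delta (i : 'I_N) a : {ffun 'I_N -> A} :=
  [ffun j => if j == i then a else 0].

Lemma lin_formD (e : 'I_N -> K) x x' :
  lin_form e (x + x') = lin_form e x + lin_form e x'.
Proof.
by rewrite -big_split; apply: eq_bigr => i _; rewrite ffunE scalerDr.
Qed.
Lemma quad_formDl (e : 'I_N -> 'I_N -> K) x x' y :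
  quad_form e (x + x') y = quad_form e x y + quad_form e x' y.
Proof.
rewrite -big_split; apply: eq_bigr => i _; rewrite -big_split.
by apply: eq_bigr => j _; rewrite ffunE brDl scalerDr.
Qed.
Lemma quad_formDr (e : 'I_N -> 'I_N -> K) x y y' :
  quad_form e x (y + y') = quad_form e x y + quad_form e x y'.
Proof.
rewrite -big_split; apply: eq_bigr => i _; rewrite -big_split.
by apply: eq_bigr => j _; rewrite ffunE brDr scalerDr.
Qed.

Variables (e f : 'I_N -> 'I_N -> 'I_N -> K).
Lemma cubic_formDl x x' y z :
  cubic_form e f (x + x') y z = cubic_form e f x y z + cubic_form e f x' y z.
Proof.
do 3![rewrite -big_split; apply: eq_bigr => ? _].
by rewrite ffunE cubic_termDl.
Qed.
Lemma cubic_formDm x y y' z :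
  cubic_form e f x (y + y') z = cubic_form e f x y z + cubic_form e f x y' z.
Proof.
do 3![rewrite -big_split; apply: eq_bigr => ? _].
by rewrite ffunE cubic_termDm.
Qed.
Lemma cubic_formDr x y z z' :
  cubic_form e f x y (z + z') = cubic_form e f x y z + cubic_form e f x y z'.
Proof.
do 3![rewrite -big_split; apply: eq_bigr => ? _].
by rewrite ffunE cubic_termDr.
Qed.

Lemma lin_form_delta (g : 'I_N -> K) i a : lin_form g (delta i a) = g i *: a.
Proof.
rewrite /lin_form (bigD1 i) //= big1 ?addr0 => [|j /negPf ji]; rewrite ffunE.
  by rewrite eqxx.
by rewrite ji scaler0.
Qed.
Lemma quad_form_delta (g : 'I_N -> 'I_N -> K) i j a b :
  quad_form g (delta i a) (delta j b) = g i j *: bt_br a b.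
Proof.
rewrite /quad_form (bigD1 i) //= [X in _ + X]big1 ?addr0; last first.
  by move=> i' /negPf ii'; apply: big1 => j' _; rewrite ffunE ii' br0l scaler0.
rewrite (bigD1 j) //= big1 ?addr0 => [|j' /negPf jj']; rewrite !ffunE ?eqxx //.
by rewrite jj' br0r scaler0.
Qed.
Lemma cubic_form_delta i j k a b c :
  cubic_form e f (delta i a) (delta j b) (delta k c)
  = cubic_term (e i j k) (f i j k) a b c.
Proof.
rewrite /cubic_form (bigD1 i) //= [X in _ + X]big1 ?addr0; last first.
  move=> i' /negPf ii'; apply: big1 => j' _; apply: big1 => k' _.
  by rewrite ffunE ii' cubic_term0l.
rewrite (bigD1 j) //= [X in _ + X]big1 ?addr0; last first.
  by move=> j' /negPf jj'; apply: big1 => k' _; rewrite 2!ffunE jj' cubic_term0m.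
rewrite (bigD1 k) //= big1 ?addr0 => [|k' /negPf kk']; rewrite !ffunE ?eqxx //.
by rewrite kk' cubic_term0r.
Qed.

End Forms.
End MultilinearForms.

(** * The polarized cubic part *)

Section CubicPolar.
Variables (K : fieldType) (A : btAlgebra K) (N : nat).
Implicit Types (d t D T : 'I_N -> 'I_N -> 'I_N -> K) (x y z : {ffun 'I_N -> A}).

(** The six permutations of (a,b,c), paired by skew-symmetry into the three
    cyclic rotations. *)
Definition cubic_polar D T i j k (a b c : A) : A :=
  cubic_term (D i j k) (T i j k) a b c + cubic_term (D j k i) (T j k i) b c a
  + cubic_term (D k i j) (T k i j) c a b.

Definition alternate d i j k : K := d i j k - d j i k.

(** Nothing is assumed on i, j, k: repeated indices, that is identities in which
    a variable occurs twice, are covered by the same formula. *)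
Lemma cubic_form_polar_delta d t i j k (a b c : A) :
  anticommutative A -> skew_triple A ->
  let F := cubic_form d t in
  let x := delta i a in let y := delta j b in let z := delta k c in
  (F x y z + F y x z) + (F y z x + F z y x) + (F z x y + F x z y)
  = cubic_polar (alternate d) (alternate t) i j k a b c.
Proof.
by move=> antiA skewA; rewrite /= !cubic_form_delta !skew_pair_cubic_term.
Qed.

(** Summing the cubic part over all six orders of the summation indices: a
    factor 2 comes from pairing (i,j,k) with (j,i,k), a factor 3 from the cyclic
    rotations. *)
Lemma cubic_form_cyclic_sum d t x :
  anticommutative A -> skew_triple A ->
  cubic_form d t x x x *+ 6
  = \sum_i \sum_j \sum_k
      cubic_polar (alternate d) (alternate t) i j k (x i) (x j) (x k).
Proof.
move=> antiA skewA.
pose G i j k :=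
  cubic_term (alternate d i j k) (alternate t i j k) (x i) (x j) (x k).
have F2 : cubic_form d t x x x *+ 2 = \sum_i \sum_j \sum_k G i j k.
  rewrite mulr2n {2}/cubic_form exchange_big -big_split /=.
  apply: eq_bigr => i _; rewrite -big_split; apply: eq_bigr => j _ /=.
  rewrite -big_split; apply: eq_bigr => k _ /=.
  by rewrite skew_pair_cubic_term.
have Grot : \sum_i \sum_j \sum_k G j k i = \sum_i \sum_j \sum_k G i j k.
  rewrite exchange_big; apply: eq_bigr => i _.
  by rewrite exchange_big.
have Grot2 : \sum_i \sum_j \sum_k G k i j = \sum_i \sum_j \sum_k G i j k.
  under eq_bigr => i _ do rewrite exchange_big.
  by rewrite exchange_big.
rewrite -[6%N]/(2 * 3)%N mulrnA F2 mulrS mulr2n -{2}Grot -{2}Grot2 addrA.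
by do 3![rewrite -!big_split /=; apply: eq_bigr => ? _].
Qed.

End CubicPolar.

(** * Products of weight vectors of V(6) *)

Section V6Products.
Variable K : fieldType.
Local Notation v := (v_ K).

Lemma vcoef_v p q :
  vcoef p (v q) = ((p == q) && (p \in [seq weight i | i <- iota 0 7]))%:R.
Proof.
have [/mapP[n]|Np] := boolP (p \in _).
  rewrite mem_iota => /= lt_n7 ->; rewrite /vcoef (bigD1 (Ordinal lt_n7)) //=.
  rewrite big1 => [|j /andP[/eqP /= eq_w /negP[]]]; last first.
    apply/eqP/val_inj/eqP; move: eq_w => /addrI/oppr_inj/eqP.
    by rewrite (inj_eq (mulfI _)) // eq_sym.
  by rewrite addr0 mxE andbT eq_sym.
rewrite /vcoef big1 ?andbF // => i /eqP eq_w; case/negP: Np; apply/mapP.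
by exists (val i); rewrite ?mem_iota /=.
Qed.

Local Ltac eval_alpha :=
  rewrite /alpha /wedge !vcoef_v /=;
  move: (v 6) (v 4) (v 2) (v 0) (v (-2)) (v (-4)) (v (-6)) => *;
  apply/rowP => ?; rewrite !mxE; ring.

Lemma alpha_v6_v0 : alpha (v 6) (v 0) = 20 *: v 6. Proof. eval_alpha. Qed.
Lemma alpha_v0_v6 : alpha (v 0) (v 6) = - 20 *: v 6. Proof. eval_alpha. Qed.
Lemma alpha_v0_v0 : alpha (v 0) (v 0) = 0. Proof. eval_alpha. Qed.
Lemma alpha_v6_v2 : alpha (v 6) (v 2) = 0. Proof. eval_alpha. Qed.
Lemma alpha_v2_vm2 : alpha (v 2) (v (-2)) = - 15 *: v 0. Proof. eval_alpha. Qed.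
Lemma alpha_vm2_v6 : alpha (v (-2)) (v 6) = - 10 *: v 4. Proof. eval_alpha. Qed.
Lemma alpha_v4_v2 : alpha (v 4) (v 2) = - 60 *: v 6. Proof. eval_alpha. Qed.
Lemma alpha_v6_vm4 : alpha (v 6) (v (-4)) = 4 *: v 2. Proof. eval_alpha. Qed.
Lemma alpha_vm4_v6 : alpha (v (-4)) (v 6) = - 4 *: v 2. Proof. eval_alpha. Qed.
Lemma alpha_v2_vm4 : alpha (v 2) (v (-4)) = 0. Proof. eval_alpha. Qed.
Lemma alpha_vm4_vm4 : alpha (v (-4)) (v (-4)) = 0. Proof. eval_alpha. Qed.

Local Ltac eval_beta :=
  rewrite /beta /beta0 /wedge !vcoef_v /=;
  apply/matrixP => ? ?; rewrite !mxE; ring.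

Lemma beta_v6_vm4 : beta (v 6) (v (-4)) = 60 *: sl2E K. Proof. eval_beta. Qed.
Lemma beta_vm4_v6 : beta (v (-4)) (v 6) = - 60 *: sl2E K. Proof. eval_beta. Qed.
Lemma beta_vm4_vm4 : beta (v (-4)) (v (-4)) = 0. Proof. eval_beta. Qed.
Lemma beta_v6_v0 : beta (v 6) (v 0) = 0. Proof. eval_beta. Qed.
Lemma beta_v0_v6 : beta (v 0) (v 6) = 0. Proof. eval_beta. Qed.
Lemma beta_v0_v0 : beta (v 0) (v 0) = 0. Proof. eval_beta. Qed.
Lemma beta_v6_v2 : beta (v 6) (v 2) = 0. Proof. eval_beta. Qed.
Lemma beta_v2_vm2 : beta (v 2) (v (-2)) = - 150 *: sl2H K. Proof. eval_beta. Qed.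
Lemma beta_vm2_v6 : beta (v (-2)) (v 6) = 0. Proof. eval_beta. Qed.

Lemma act0 x : act (0 : 'M[K]_2) x = 0.
Proof. by rewrite /act !mxE !scale0r !addr0. Qed.

Lemma act_sl2E k x : act (k *: sl2E K) x = k *: actE x.
Proof. by rewrite /act !mxE /= !mulr0 mulr1 !scale0r add0r addr0. Qed.
Lemma act_sl2H k x : act (k *: sl2H K) x = k *: actH x.
Proof. by rewrite /act !mxE /= !subrr subr0 !mulr0 mulr1 !scale0r !addr0. Qed.

Lemma actE_vm4 : actE (v (-4)) = 2 *: v (-2).
Proof.
rewrite /actE /linear_ext !big_ord_recr big_ord0 !mxE /=.
by apply/rowP => i; rewrite !mxE /=; ring.
Qed.
Lemma actH_v6 : actH (v 6) = 6 *: v 6.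
Proof.
rewrite /actH /linear_ext !big_ord_recr big_ord0 !mxE /=.
by apply/rowP => i; rewrite !mxE /=; ring.
Qed.

Lemma alpha0l x : alpha 0 x = 0 :> 'rV[K]_7.
Proof. exact: (@br0l K (V6 K)). Qed.

Lemma alphaZl k x y : alpha (k *: x) y = k *: alpha x y :> 'rV[K]_7.
Proof. by have := alpha_is_linear1 y k x 0; rewrite alpha0l !addr0. Qed.

Lemma V6_anticommutative : anticommutative (V6 K).
Proof. by move=> x y; apply/rowP => i; rewrite /= /alpha /wedge !mxE; ring. Qed.

Lemma V6_skew_triple : skew_triple (V6 K).
Proof.
move=> x y z /=; have -> : beta x y = - beta y x.
  by apply/matrixP => i j; rewrite /beta /beta0 /wedge !mxE; ring.
by have := act_is_linear_l z (- 1) (beta y x) 0; rewrite act0 !addr0 !scaleN1r.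
Qed.

End V6Products.

(** * Coefficients of an identity of V(6) *)

(** Polarization takes place in the scalars, one coordinate of V(6) at a time, and
    is applied to tuples with one nonzero entry. *)
Lemma V6_polar_identities (K : fieldType) (p : napoly K) N :
  has_char0 K -> (degree p <= 3)%N ->
  (forall m, m \in msupp p -> (var_bound m <= N)%N) -> satisfies (V6 K) p ->
  [/\ forall (i : 'I_N) (a : V6 K), lin_coef p i *: a = 0,
      forall (i j : 'I_N) (a b : V6 K),
        (quad_coef p i j - quad_coef p j i) *: bt_br a b = 0 &
      forall (i j k : 'I_N) (a b c : V6 K),
        cubic_polar (alternate (brbr_coef p)) (alternate (tr_coef p))
          i j k a b c = 0].
Proof.
move=> char0 degp boundp satp.
pose X := {ffun 'I_N -> V6 K}.
pose L (x : X) := lin_form (lin_coef p) x.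
pose Q (x y : X) := quad_form (quad_coef p) x y.
pose C (x y z : X) := cubic_form (brbr_coef p) (tr_coef p) x y z.
have LQC0 x : L x + Q x x + C x x x = 0.
  pose s n : V6 K := oapp x 0 (insub n).
  rewrite -(@peval_degree3 _ _ _ _ s) // => [|i]; first exact: V6_anticommutative.
  by rewrite /s valK.
pose co l (u : V6 K) : K := (u : 'rV[K]_7) 0 l.
have coD l u u' : co l (u + u') = co l u + co l u' by rewrite /co mxE.
have co0 u : (forall l, co l u = 0) -> u = 0.
  by move=> u0; apply/rowP => l; rewrite mxE; exact: u0.
have polar l : [/\ forall x, co l (L x) = 0,
    forall x y, co l (Q x y) + co l (Q y x) = 0
  & forall x y z, (co l (C x y z) + co l (C y x z))
      + (co l (C y z x) + co l (C z y x))
      + (co l (C z x y) + co l (C x z y)) = 0].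
  apply: (@polarization X K (fun x => co l (L x)) (fun x y => co l (Q x y))
            (fun x y z => co l (C x y z)) char0) => [*|*|*|*|*|*|x].
  - by rewrite /L lin_formD coD.
  - by rewrite /Q quad_formDl coD.
  - by rewrite /Q quad_formDr coD.
  - by rewrite /C cubic_formDl coD.
  - by rewrite /C cubic_formDm coD.
  - by rewrite /C cubic_formDr coD.
  - by rewrite -!coD LQC0 /co mxE.
split.
- move=> i a; apply: co0 => l; have [L0 _ _] := polar l.
  by rewrite -lin_form_delta; exact: L0.
- move=> i j a b; apply: co0 => l; have [_ Q0 _] := polar l.
  rewrite scalerBl -scalerN -[- bt_br a b]V6_anticommutative.
  by rewrite -!quad_form_delta coD; exact: Q0.
- move=> i j k a b c; apply: co0 => l; have [_ _ C0] := polar l.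
  rewrite -cubic_form_polar_delta ?coD; first exact: C0.
    exact: V6_anticommutative.
  exact: V6_skew_triple.
Qed.

(** The six coefficients at (i,j,k) are subject to one linear equation per
    choice of three weight vectors. As the hypothesis holds at all triples of
    indices, an equation between two coefficients can be rotated cyclically, which
    is why three choices are enough for the rank 5 of the system. *)
Lemma V6_cubic_polar_coef (K : fieldType) N (D T : 'I_N -> 'I_N -> 'I_N -> K) :
  has_char0 K ->
  (forall i j k (a b c : V6 K), cubic_polar D T i j k a b c = 0) ->
  forall i j k, [/\ D j k i = D i j k, D k i j = D i j k, T i j k = D i j k,
    T j k i = D i j k & T k i j = D i j k].
Proof.
move=> /pcharf0P char0 P0.
have scal_v n c r : (r \in [seq weight i | i <- iota 0 7]) ->
    (n.+1%:R * c) *: v_ K r = 0 -> c = 0.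
  move=> r_wt /(congr1 (vcoef r)); rewrite vcoefZ vcoef_v eqxx r_wt mulr1.
  rewrite /vcoef big1 => [/eqP|l _]; last by rewrite mxE.
  by rewrite mulf_eq0 char0 => /eqP.
have Dcyc i j k : D k i j = D i j k.
  have := P0 i j k (v_ K 6) (v_ K 0) (v_ K 0).
  rewrite /cubic_polar /cubic_term /= !(alpha_v6_v0, alpha_v0_v6, alpha_v0_v0).
  rewrite !alphaZl alpha0l !(alpha_v6_v0, alpha_v0_v6).
  rewrite !(beta_v6_v0, beta_v0_v6, beta_v0_v0) !act0.
  rewrite !scaler0 !addr0 !scalerA -scalerDl => eq0.
  (* [[v_6,v_0],v_0] = 400 v_6 = - [[v_0,v_6],v_0]. *)
  apply/esym/eqP; rewrite -subr_eq0; apply/eqP; apply: (scal_v 399%N _ 6) => //.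
  by rewrite -[RHS]eq0; congr (_ *: _); ring.
have Tcyc i j k : T k i j = T i j k.
  have := P0 i j k (v_ K 6) (v_ K (-4)) (v_ K (-4)).
  rewrite /cubic_polar /cubic_term /= !(alpha_v6_vm4, alpha_vm4_v6, alpha_vm4_vm4).
  rewrite !alphaZl alpha0l alpha_v2_vm4.
  rewrite !(beta_v6_vm4, beta_vm4_v6, beta_vm4_vm4) act0 !act_sl2E actE_vm4.
  rewrite !scaler0 !addr0 !add0r !scalerA -scalerDl => eq0.
  (* (v_6,v_-4,v_-4) = 120 v_-2 = - (v_-4,v_6,v_-4). *)
  apply/esym/eqP; rewrite -subr_eq0; apply/eqP; apply: (scal_v 119%N _ (-2)) => //.
  by rewrite -[RHS]eq0; congr (_ *: _); ring.
have DT i j k : T i j k = D i j k.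
  have := P0 i j k (v_ K 6) (v_ K 2) (v_ K (-2)).
  rewrite /cubic_polar /cubic_term /= !(alpha_v6_v2, alpha_v2_vm2, alpha_vm2_v6).
  rewrite !alphaZl alpha0l alpha_v0_v6 alpha_v4_v2.
  rewrite !(beta_v6_v2, beta_v2_vm2, beta_vm2_v6) !act0 act_sl2H actH_v6.
  rewrite !scaler0 !addr0 !add0r !scalerA -!scalerDl -(Dcyc j k i) -(Dcyc i j k).
  rewrite (Dcyc i j k) -(Tcyc j k i) => eq0.
  (* [[v_2,v_-2],v_6] = 300 v_6, [[v_-2,v_6],v_2] = 600 v_6 and
     (v_2,v_-2,v_6) = - 900 v_6; the other three terms vanish. *)
  apply/esym/eqP; rewrite -subr_eq0; apply/eqP; apply: (scal_v 899%N _ 6) => //.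
  by rewrite -[RHS]eq0; congr (_ *: _); ring.
by move=> i j k; rewrite !DT -(Dcyc j k i) (Dcyc i j k).
Qed.

(** * Identities of degree at most three *)

Definition mixed_jacobi_law (K : fieldType) (A : btAlgebra K) := forall a b c : A,
  bt_br (bt_br a b) c + bt_br (bt_br b c) a + bt_br (bt_br c a) b
  + bt_tr a b c + bt_tr b c a + bt_tr c a b = 0.

Lemma char0_scaler_nat (K : fieldType) (A : lmodType K) (x : A) n :
  has_char0 K -> x *+ n.+1 = 0 -> x = 0.
Proof.
move=> /pcharf0P char0 /eqP; rewrite -scaler_nat scaler_eq0 char0.
by move/eqP.
Qed.

Lemma degree3_consequence (K : fieldType) (p : napoly K) :
  has_char0 K -> (degree p <= 3)%N -> satisfies (V6 K) p ->
  consequence (fun q => [\/ q = anticommutativity K, q = skew_symmetry K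
                          | q = mixed_jacobi K]) p.
Proof.
move=> char0 degp satp A lawA s.
pose env (a b c : A) n : A :=
  if n is n'.+1 then if n' is _.+1 then c else b else a.
have antiA : anticommutative A.
  move=> a b; have := lawA _ (Or31 _ _ erefl) (env a b b).
  by rewrite !pevalD !pevalU /= => /eqP; rewrite addr_eq0 => /eqP.
have skewA : skew_triple A.
  move=> a b c; have := lawA _ (Or32 _ _ erefl) (env a b c).
  by rewrite !pevalD !pevalU /= => /eqP; rewrite addr_eq0 => /eqP.
have jacA : mixed_jacobi_law A.
  move=> a b c; have := lawA _ (Or33 _ _ erefl) (env a b c).
  by rewrite !pevalD !pevalU.
pose N := (\max_(m <- msupp p) var_bound m)%N.
have boundp m : m \in msupp p -> (var_bound m <= N)%N.
  by move=> mp; exact: (leq_bigmax_seq _ mp).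
have [L0 Q0 C0] := V6_polar_identities char0 degp boundp satp.
have coefs := V6_cubic_polar_coef char0 C0.
have v6_neq0 k : k *: v_ K 6 = 0 -> k = 0.
  by move/(congr1 (fun u : 'rV[K]_7 => u 0 0)); rewrite !mxE /= mulr1.
rewrite (@peval_degree3 _ _ _ N s [ffun i : 'I_N => s i]) //; last first.
  by move=> i; rewrite ffunE.
set x := finfun _.
have -> : lin_form (lin_coef p) x = 0.
  by apply: big1 => i _; rewrite (v6_neq0 _ (L0 i (v_ K 6))) scale0r.
have -> : quad_form (quad_coef p) x x = 0.
  apply: (@char0_scaler_nat _ _ _ 1 char0).
  (* Each index pair is combined with its transpose. *)
  rewrite mulr2n {2}/quad_form exchange_big -big_split big1 //= => i _.
  rewrite -big_split big1 //= => j _.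
  rewrite [bt_br (x j) _]antiA scalerN -scalerBl.
  have := Q0 i j (v_ K 6) (v_ K 0); rewrite /= alpha_v6_v0 scalerA.
  move/v6_neq0/eqP; rewrite mulf_eq0 ((pcharf0P K).1 char0) orbF => /eqP ->.
  exact: scale0r.
have -> : cubic_form (brbr_coef p) (tr_coef p) x x x = 0.
  apply: (@char0_scaler_nat _ _ _ 5 char0).
  rewrite cubic_form_cyclic_sum //.
  rewrite big1 //= => i _; rewrite big1 //= => j _; rewrite big1 //= => k _.
  rewrite /cubic_polar; have [-> -> -> -> ->] := coefs i j k.
  rewrite /cubic_term -!scalerDr (addrACA (bt_br _ _)).
  by rewrite (addrACA (bt_br _ _ + _)) !addrA jacA scaler0.
by rewrite !addr0.
Qed.

Theorem lemma6p1 (R : realType) (p : napoly R[i]) :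
  (degree p <= 3)%N ->
  satisfies (V6 R[i]) p ->
  consequence
    (fun q : napoly R[i] =>
       [\/ q = anticommutativity R[i], q = skew_symmetry R[i]
         | q = mixed_jacobi R[i]])
    p.
Proof.
apply: degree3_consequence; exact: Num.Theory.pchar_num.
Qed.
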